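(* For each dimension $d\geq 2$ there exist numbers $f(d)$ and $g(d)$ with the following property. Let $\mathcal{F}$ be a finite $(d+1)$-colored family of convex sets in $\mathbb{R}^d$, with color classes $\mathcal{F}_1,\dots,\mathcal{F}_{d+1}$, that satisfies the Colorful Helly property $\mathcal{CH}(\mathcal{F}_1,\dots,\mathcal{F}_{d+1})$. Let $i\in[d+1]$ be a color whose class $\mathcal{F}_i$ has non-empty intersection $\bigcap\mathcal{F}_i\neq\emptyset$ (such a color exists by the Colorful Helly Theorem of Lovász). Then one of the following holds: (1) an additional color class $\mathcal{F}_j$, for some $j\in[d+1]\setminus\{i\}$, can be pierced by $f(d)$ points; or (2) the entire family $\mathcal{F}$ can be crossed by $g(d)$ lines.
   Context: A finite family $\mathcal{F}$ of convex sets is $k$-colored if each set is colored with (at least) one of $k$ colors; $\mathcal{F}=\mathcal{F}_1\cup\dots\cup\mathcal{F}_k$, where $\mathcal{F}_i$ is the class of sets with color $i$. The family has the Colorful Helly property $\mathcal{CH}(\mathcal{F}_1,\dots,\mathcal{F}_k)$ if every rainbow selection $K_i\in\mathcal{F}_i$, $1\le i\le k$, satisfies $\bigcap_{i=1}^k K_i\neq\emptyset$. A collection $X$ of points (resp. lines, $k$-flats) pierces/crosses a family if every set of the family is intersected by some member of $X$. *)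

(* Defs.v *)
From mathcomp Require Import all_boot all_order all_algebra.
From mathcomp Require Import boolp classical_sets functions cardinality reals convex.

Set Implicit Arguments.
Unset Strict Implicit.
Unset Printing Implicit Defensive.

Import Order.TTheory GRing.Theory Num.Theory.

Local Open Scope classical_set_scope.
Local Open Scope card_scope.
Local Open Scope ring_scope.

(* A k-coloured family of subsets of V is given by its colour classes
   F : 'I_k -> set (set V).  The classes need not be disjoint, so a set may
   carry several colours; the whole family is \bigcup_j F j. *)
Definition colorful_helly (V : Type) (k : nat) (F : 'I_k -> set (set V)) : Prop :=
  forall K : 'I_k -> set V,
    (forall j, F j (K j)) -> \bigcap_j K j !=set0.

(* X #<= `I_n says that X is finite with at most n elements. *)
Definition pierced_by_points (V : Type) (n : nat) (G : set (set V)) : Prop :=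
  exists X : set V,
    X #<= `I_n /\ forall K, G K -> exists2 x, X x & K x.

Definition is_line (R : realType) (d : nat) (l : set 'rV[R]_d) : Prop :=
  exists p v : 'rV[R]_d, v != 0 /\ l = [set p + t *: v | t in [set: R]].

Definition crossed_by_lines (R : realType) (d n : nat)
    (G : set (set 'rV[R]_d)) : Prop :=
  exists L : set (set 'rV[R]_d),
    [/\ L #<= `I_n,
        forall l, L l -> is_line l &
        forall K, G K -> exists2 l, L l & l `&` K !=set0].

(* Main.v *)
(** Only the d colors other than i matter, since one line through a common
    point of F_i crosses F_i. If no such class can be pierced by f points, a
    (p,q)-theorem yields in each class N sets, no 2^d of which have a common
    point. Fix a color j, and let C be a set of F_j and S_1, ..., S_(d-1) the
    families of N sets chosen from the other classes. As 2^d sets of S_1 have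
    no common point, there are boundedly many hyperplanes such that every
    convex set meeting all of these sets meets one of the hyperplanes; this
    applies to the intersection of C with any selection from S_2, ...,
    S_(d-1). A product Ramsey theorem makes the hyperplane independent of the
    selection on large subfamilies of S_2, ..., S_(d-1), so the argument
    repeats inside the hyperplane. After d-1 steps C is crossed by one of
    boundedly many lines.

    The (p,q)-theorem follows Alon and Kleitman (fractional Helly, fractional
    transversal, weak epsilon-net), but using 2^d-tuples in place of
    (d+1)-tuples lets both the fractional Helly theorem and the weak epsilon-
    nets be proved by slicing with a hyperplane x_0 = m and induction on d,
    without compactness. *)

Require Import Defs.
From mathcomp Require Import all_boot all_order all_algebra.
From mathcomp Require Import boolp classical_sets functions cardinality reals convex.
From mathcomp Require Import interval_inference ring lra.

Set Implicit Arguments.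
Unset Strict Implicit.
Unset Printing Implicit Defensive.

Import Order.TTheory GRing.Theory Num.Theory.

Local Open Scope classical_set_scope.
Local Open Scope ring_scope.

(** * Separation of convex sets *)

Lemma convex_setP (R : realType) (V : lmodType R) (A : set V) :
  convex_set A <->
  forall x y t, 0 <= t -> t <= 1 -> A x -> A y -> A (t *: x + (1 - t) *: y).
Proof.
split=> [cA x y t t0 t1 Ax Ay|cA x y t].
  have ht : interval_inference.Itv.spec
      (@interval_inference.Itv.num_sem R)
      (interval_inference.Itv.Real `[0%Z, 1%Z]%R) t.
    by rewrite /= /interval_inference.Itv.num_sem ger0_real//= in_itv/= t0 t1.
  have := cA x y (interval_inference.Itv.mk ht).
  by rewrite !inE => /(_ Ax Ay).
rewrite !inE => Ax Ay; exact: cA.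
Qed.

Lemma convex_bigcap (R : realType) (V : lmodType R) (J : Type)
    (A : J -> set V) :
  (forall j, convex_set (A j)) -> convex_set (\bigcap_j A j).
Proof.
move=> cA; apply/convex_setP => x y t t0 t1 Ax Ay j _.
by move/convex_setP: (cA j); apply=> //; [exact: Ax|exact: Ay].
Qed.

Lemma convex_setI (R : realType) (V : lmodType R) (A B : set V) :
  convex_set A -> convex_set B -> convex_set (A `&` B).
Proof.
move=> /convex_setP cA /convex_setP cB; apply/convex_setP.
by move=> x y t t0 t1 [Ax Bx] [Ay By]; split; [exact: cA|exact: cB].
Qed.

(** Slices [x_0 = m] and parametrized hyperplanes are both handled by pulling back along an affine
    map of this form. *)
Lemma convex_preimage (R : realType) (m n : nat) (M : 'M[R]_(m, n)) (p : 'rV_n)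
    (A : set 'rV[R]_n) :
  convex_set A -> convex_set ((fun y : 'rV_m => y *m M + p) @^-1` A).
Proof.
move=> /convex_setP cA; apply/convex_setP => x y t t0 t1 /= Ax Ay.
have := cA _ _ t t0 t1 Ax Ay; congr A.
rewrite mulmxDl -!scalemxAl !scalerDr addrACA -scalerDl.
by rewrite subrKC scale1r.
Qed.

Definition functional (R : realType) (n : nat) (u : 'cV[R]_n) (x : 'rV[R]_n) : R :=
  (x *m u) 0 0.

Lemma functionalD (R : realType) n (u : 'cV[R]_n) x y :
  functional u (x + y) = functional u x + functional u y.
Proof. by rewrite /functional mulmxDl mxE. Qed.

Lemma functionalZ (R : realType) n (u : 'cV[R]_n) t x :
  functional u (t *: x) = t * functional u x.
Proof. by rewrite /functional -scalemxAl mxE. Qed.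

Lemma functionalN (R : realType) n (u : 'cV[R]_n) x :
  functional u (- x) = - functional u x.
Proof. by rewrite -scaleN1r functionalZ mulN1r. Qed.

Lemma convex_meets_level (R : realType) n (C : set 'rV[R]_n) (u : 'cV[R]_n) x y b :
  convex_set C -> C x -> C y -> functional u x <= b -> b <= functional u y ->
  exists2 z, C z & functional u z = b.
Proof.
move=> /convex_setP cC Cx Cy xb byy.
have [e|ne] := eqVneq (functional u x) (functional u y).
  by exists x => //; apply/le_anti; rewrite xb e byy.
have xy : 0 < functional u y - functional u x.
  by rewrite subr_gt0 lt_neqAle ne (le_trans xb).
set D := functional u y - functional u x in xy *.
(* The weight is the one at which [functional u], affine along the segment, takes the value [b]. *)
exists (((functional u y - b) / D) *: x + (1 - (functional u y - b) / D) *: y).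
  apply: cC => //; first by apply: divr_ge0 (ltW xy); rewrite subr_ge0.
  by rewrite ler_pdivrMr// mul1r /D lerD2l lerN2.
rewrite functionalD !functionalZ /D; field.
by rewrite lt0r_neq0.
Qed.

Lemma convex_halfspace (R : realType) n (u : 'cV[R]_n) b :
  convex_set [set x | b < functional u x].
Proof.
apply/convex_setP => x y t t0 t1 /= bx bY.
rewrite functionalD !functionalZ.
have [->|tN0] := eqVneq t 0; first by rewrite mul0r add0r subr0 mul1r.
have : 0 < t * (functional u x - b) by rewrite mulr_gt0 ?subr_gt0// lt_neqAle eq_sym tN0.
have : 0 <= (1 - t) * (functional u y - b) by rewrite mulr_ge0 ?subr_ge0// ltW.
lra.
Qed.

(* Hahn-Banach, one coordinate at a time: a functional that is nonnegative on
   the slice [x_0 = 0] extends, its value on the first basis vector being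
   squeezed between the constraints given by the two sides of the slice. *)
Lemma convex_functional_ge0 (R : realType) n (D : set 'rV[R]_n) :
  convex_set D -> ~ D 0 -> D !=set0 ->
  exists2 u : 'cV[R]_n, u != 0 & forall x, D x -> 0 <= functional u x.
Proof.
elim: n D => [|n IH] D cD D0 [x0 Dx0].
  by exfalso; apply: D0; rewrite -(thinmx0 x0).
pose e0 : 'cV[R]_(1 + n) := col_mx 1 0.
have e0N0 : e0 != 0.
  apply/eqP => /(congr1 (fun M : 'cV_(1 + n) => M (lshift n 0) 0)).
  by rewrite col_mxEu !mxE/= => /eqP; rewrite oner_eq0.
have fE (v : 'cV_n) a (x : 'rV_(1 + n)) :
    functional (col_mx a%:M v : 'cV_(1 + n)) x
    = a * functional e0 x + functional v (rsubmx x).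
  rewrite /functional -(hsubmxK x) !mul_row_col mulmx0 addr0 mulmx1.
  by rewrite mul_mx_scalar !mxE row_mxKr.
(* If [D] lies weakly on one side of the slice, [e0] or [- e0] works. Otherwise [a] and [b] lie
   strictly on opposite sides, so the slice is nonempty and the induction hypothesis applies to
   it. *)
have [hp|/existsNP[a /not_implyP[Da /negP]]] :=
    pselect (forall x, D x -> 0 <= functional e0 x); first by exists e0.
rewrite -ltNge => a0.
have [hn|/existsNP[b /not_implyP[Db /negP]]] :=
    pselect (forall x, D x -> functional e0 x <= 0).
  exists (- e0); first by rewrite oppr_eq0.
  by move=> x Dx; rewrite /functional mulmxN mxE oppr_ge0 hn.
rewrite -ltNge => b0.
pose M : 'M[R]_(n, 1 + n) := row_mx 0 1%:M.
have functional0 (x : 'rV_(1 + n)) : functional e0 x = 0 -> rsubmx x *m M = x.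
  move=> fx; rewrite /M mul_mx_row mulmx1 mulmx0 -{2}(hsubmxK x); congr row_mx.
  apply/rowP => i; rewrite ord1 mxE -fx /functional -(hsubmxK x) mul_row_col.
  by rewrite mulmx0 addr0 mulmx1 row_mxKl.
pose tl : 'rV[R]_n.+1 -> 'rV_n := @rsubmx R 1 1 n.
pose D' := (fun y : 'rV_n => y *m M + 0) @^-1` D.
have D'N (x : 'rV_(1 + n)) : D x -> functional e0 x = 0 -> D' (tl x).
  by move=> Dx fx; rewrite /D' /= addr0 functional0.
have [] := IH D'.
- exact: convex_preimage.
- by rewrite /D' /= mul0mx addr0.
- have [z Dz fz] := convex_meets_level cD Da Db (ltW a0) (ltW b0).
  by exists (tl z); exact: D'N.
move=> v vN0 vge.
(* Elements of [P] are the lower bounds that points with positive first coordinate impose on the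
   coefficient of [e0]. By [key] they stay below the upper bounds from the other side: the segment
   [x y] crosses the slice, where [v] is nonnegative. *)
pose P : set R := [set - functional v (tl x) / functional e0 x
  | x in [set x | D x /\ 0 < functional e0 x]].
have key x y : D x -> 0 < functional e0 x -> D y -> functional e0 y < 0 ->
    - functional v (tl x) / functional e0 x
    <= functional v (tl y) / - functional e0 y.
  move=> Dx x1 Dy y1.
  set s := functional e0 x in x1 *; set r := functional e0 y in y1 *.
  have sr : 0 < s - r by lra.
  pose t := - r / (s - r).
  pose z := t *: x + (1 - t) *: y.
  have Dz : D z.
    move/convex_setP: cD; apply=> //; first by rewrite divr_ge0//; lra.
    by rewrite ler_pdivrMr//; lra.
  have fz : functional e0 z = 0.
    by rewrite functionalD !functionalZ -/s -/r /t; field; lra.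
  have := vge _ (D'N _ Dz fz).
  rewrite /z /tl linearD !linearZ/= functionalD !functionalZ /t.
  set X := functional v _; set Y := functional v _.
  have -> : - r / (s - r) * X + (1 - - r / (s - r)) * Y
     = (s * Y - r * X) / (s - r) by field; lra.
  rewrite pmulr_lge0 ?invr_gt0// => h.
  rewrite ler_pdivrMr// mulrAC ler_pdivlMr; lra.
have supP : has_sup P.
  split; first by exists (- functional v (tl b) / functional e0 b); exists b.
  exists (functional v (tl a) / - functional e0 a).
  by move=> _ [x [Dx x1] <-]; exact: key.
exists (col_mx (sup P)%:M v : 'cV_(1 + n)).
  apply: contra vN0 => /eqP h; apply/eqP.
  by rewrite -(col_mxKd (sup P)%:M v) h linear0.
move=> x Dx; rewrite fE.
have [x1|x1|x1] := ltrgtP (functional e0 x) 0.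
- have : sup P <= functional v (tl x) / - functional e0 x.
    apply: ge_sup; first by case: supP.
    by move=> _ [y [Dy y1] <-]; exact: key.
  by rewrite ler_pdivlMr; lra.
- have : - functional v (tl x) / functional e0 x <= sup P.
    by apply: sup_upper_bound => //; exists x.
  by rewrite ler_pdivrMr//; lra.
- by rewrite x1 mulr0 add0r; apply: vge; exact: D'N.
Qed.

(** The set of differences [y - x] is convex and avoids 0, so some functional is nonnegative on it;
    [b] is the supremum of this functional over [A]. *)
Lemma convex_separation (R : realType) n (A B : set 'rV[R]_n) :
  convex_set A -> convex_set B -> A !=set0 -> B !=set0 -> A `&` B = set0 ->
  exists2 u : 'cV[R]_n, u != 0 &
    exists b, (forall x, A x -> functional u x <= b) /\
              (forall y, B y -> b <= functional u y).
Proof.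
move=> /convex_setP cA /convex_setP cB [a0 Aa0] [b0 Bb0] AB.
pose D : set 'rV[R]_n := [set z | exists x y, [/\ A x, B y & z = y - x]].
have [] := @convex_functional_ge0 R n D.
- apply/convex_setP => _ _ t t0 t1 [x [y [Ax By ->]]] [x' [y' [Ax' By' ->]]].
  exists (t *: x + (1 - t) *: x'), (t *: y + (1 - t) *: y'); split.
  + exact: cA.
  + exact: cB.
  + by rewrite !scalerBr addrACA opprD.
- move=> [x [y [Ax By /eqP]]]; rewrite eq_sym subr_eq0 => /eqP xy.
  have : (A `&` B) x by split=> //; rewrite -xy.
  by rewrite AB.
- by exists (b0 - a0), a0, b0.
move=> u uN0 uD; exists u => //.
have uAB x y : A x -> B y -> functional u x <= functional u y.
  move=> Ax By; rewrite -subr_ge0 -functionalN -functionalD.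
  by apply: uD; exists x, y.
pose S : set R := [set functional u x | x in A].
have hS : has_sup S.
  split; first by exists (functional u a0), a0.
  by exists (functional u b0) => _ [x Ax <-]; exact: uAB.
exists (sup S); split=> [x Ax|y By].
  by apply: sup_upper_bound => //; exists x.
by apply: ge_sup; [case: hS|move=> _ [x Ax <-]; exact: uAB].
Qed.

(* If C misses a hyperplane weakly separating K i from the intersection of the
   remaining sets, then C lies strictly on the side of K i, where the remaining
   sets have no common point; so the open half-space is added to S. *)
Lemma separating_hyperplanes (R : realType) n (I : eqType) (K : I -> set 'rV[R]_n)
    (s : seq I) (S : set 'rV[R]_n) :
  (forall i, convex_set (K i)) -> convex_set S ->
  (forall x, S x -> exists2 i, i \in s & ~ K i x) ->
  exists2 h : seq ('cV[R]_n * R), size h = size s &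
    forall C : set 'rV[R]_n, convex_set C -> C !=set0 -> C `<=` S ->
      (forall i, i \in s -> C `&` K i !=set0) ->
      exists2 a, (a < size s)%N &
        (nth (0, 0) h a).1 != 0 /\
        exists2 z, C z & functional (nth (0, 0) h a).1 z = (nth (0, 0) h a).2.
Proof.
move=> cK; elim: s S => [|i s IH] S cS Ks.
  exists [::] => // C _ [x Cx] CS.
  by have [] := Ks _ (CS _ Cx).
pose G := S `&` \bigcap_(j in [set` s]) K j.
have cG : convex_set G.
  apply: convex_setI => //; apply/convex_setP => x y t t0 t1 Kx Ky j js.
  by move/convex_setP: (cK j); apply=> //; [exact: Kx|exact: Ky].
have KG : K i `&` G = set0.
  rewrite -subset0 => x [Kx [Sx sx]]; have [j] := Ks _ Sx.
  by rewrite inE => /orP[/eqP->//|js]; apply; exact: sx.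
have [[x0 Kx0]|K0] := pselect (K i !=set0); last first.
  exists (nseq (size s).+1 (0, 0)); first by rewrite size_nseq.
  move=> C _ _ _ /(_ i (mem_head _ _))[z [_ Kz]].
  by exfalso; apply: K0; exists z.
have [G0|G0] := pselect (G !=set0); last first.
  have [x Sx|h hs hC] := IH S cS.
    apply: contrapT => /forall2NP sx; apply: G0; exists x; split=> // j js.
    by have [/(_ js)|/contrapT] := sx j.
  exists ((0, 0) :: h) => /=; first by rewrite hs.
  move=> C cC C0 CS CK; have [j js|a aS ha] := hC C cC C0 CS.
    by apply: CK; rewrite inE js orbT.
  by exists a.+1.
have [u uN0 [b [ub bu]]] : exists2 u : 'cV[R]_n, u != 0 &
    exists b, (forall x, G x -> functional u x <= b) /\
              (forall y, K i y -> b <= functional u y).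
  by apply: convex_separation => //; [exists x0|rewrite setIC].
have [||h hs hC] := IH (S `&` [set x | b < functional u x]).
- by apply: convex_setI => //; exact: convex_halfspace.
- move=> x [Sx /= bx].
  apply: contrapT => /forall2NP sx.
  have : G x by split=> // j js; have [/(_ js)|/contrapT] := sx j.
  by move=> /ub; rewrite leNgt bx.
exists ((u, b) :: h) => /=; first by rewrite hs.
move=> C cC C0 CS CK.
have [[z Cz uz]|Cb] := pselect (exists2 z, C z & functional u z = b).
  by exists 0%N => //=; split=> //; exists z.
have [||a aS ha] := hC C cC C0.
- move=> x Cx; split; first exact: CS.
  rewrite /= ltNge; apply/negP => xb.
  have [k [Ck Kk]] := CK i (mem_head _ _).
  by apply: Cb; apply: (@convex_meets_level _ _ _ _ x k) => //; exact: bu.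
- by move=> j js; apply: CK; rewrite inE js orbT.
by exists a.+1.
Qed.

(** Solve the equation for a coordinate [k] with nonzero coefficient; the other coordinates serve as
    the parameters [y]. *)
Lemma hyperplane_param (R : realType) n (u : 'cV[R]_n.+1) (b : R) : u != 0 ->
  exists (M : 'M[R]_(n, n.+1)) (p : 'rV[R]_n.+1),
    forall x, functional u x = b -> exists y, x = y *m M + p.
Proof.
move=> /matrix0Pn[k [z]]; rewrite [z]ord1 => uk.
pose M : 'M[R]_(n, n.+1) :=
  \matrix_(j, l) ((l == lift k j)%:R - (l == k)%:R * u (lift k j) 0 / u k 0).
pose p : 'rV[R]_n.+1 := \row_l ((l == k)%:R * b / u k 0).
exists M, p => x xb; exists (\row_j x 0 (lift k j)).
have {}xb : x 0 k * u k 0 + \sum_j x 0 (lift k j) * u (lift k j) 0 = b.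
  by rewrite -xb /functional mxE (bigD1_ord k).
apply/rowP => l; rewrite !mxE; case: (unliftP k l) => [j|] ->.
  rewrite (bigD1 j)//= !mxE eqxx eq_sym (negbTE (neq_lift k j)) !mul0r !addr0 subr0 mulr1.
  rewrite big1 ?addr0// => i ij; rewrite !mxE (inj_eq lift_inj) eq_sym (negbTE ij).
  by rewrite (eq_sym _ k) (negbTE (neq_lift k j)) !mul0r subr0 mulr0.
rewrite eqxx mul1r -xb.
have -> : \sum_j (\row_j0 x 0 (lift k j0)) 0 j * M j k
    = - (\sum_j x 0 (lift k j) * u (lift k j) 0) / u k 0.
  rewrite mulNr mulr_suml -sumrN; apply: eq_bigr => j _.
  by rewrite !mxE eqxx (negbTE (neq_lift k j)) mul1r sub0r mulrN mulrA.
by field.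
Qed.

(** * Fractional Helly theorem and piercing *)

Section Weights.
Variables (R : realType) (I : finType) (w : I -> R).

Definition tuple_weight (J : finType) (t : {ffun J -> I}) : R := \prod_j w (t j).

(** Marginal of a product law: coordinates in the image of [e] have a prescribed value, one
    constraint each since [e] is injective, and every other coordinate sums out to 1. *)
Lemma sum_tuple_weight_fiber (J J' : finType) (e : J' -> J) (s : {ffun J' -> I}) :
  injective e -> \sum_i w i = 1 ->
  \sum_(t : {ffun J -> I} | [ffun j => t (e j)] == s) tuple_weight t = tuple_weight s.
Proof.
move=> ei w1.
pose F (j : J) (i : I) : R := if [forall k, (e k == j) ==> (s k == i)] then w i else 0.
transitivity (\sum_(t : {ffun J -> I}) \prod_j F j (t j)).
  rewrite big_mkcond; apply: eq_bigr => t _; case: ifPn => [/eqP st|/eqP ts].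
    apply: eq_bigr => j _; rewrite /F; case: ifPn => // /forallP[k].
    by apply/implyP => /eqP <-; rewrite -st ffunE.
  have [k tk] : exists k, t (e k) != s k.
    apply: contrapT => /forallNP h; apply: ts; apply/ffunP => k.
    by rewrite ffunE; have /negP := h k; rewrite negbK => /eqP.
  rewrite (bigD1 (e k))//= /F ifF ?mul0r//; apply/negP => /forallP/(_ k).
  by rewrite eqxx/= eq_sym (negbTE tk).
rewrite -bigA_distr_bigA (bigID (mem (e @: predT)))/= [X in _ * X]big1 => [|j je].
  rewrite mulr1 big_imset/=; last by move=> ? ? _ _; exact: ei.
  apply: eq_bigr => k _; rewrite /F -big_mkcond/= (big_pred1 (s k))// => i /=.
  apply/forallP/eqP => [/(_ k)|-> k'].
    by rewrite eqxx => /eqP.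
  by apply/implyP => /eqP/ei ->.
rewrite -w1; apply: eq_bigr => i _; rewrite /F ifT//; apply/forallP => k.
by apply/implyP => /eqP ek; case/negP: je; apply/imsetP; exists k.
Qed.

Lemma sum_tuple_weight_marginal (J J' : finType) (e : J' -> J)
    (B : pred {ffun J' -> I}) :
  injective e -> \sum_i w i = 1 ->
  \sum_(t : {ffun J -> I} | B [ffun j => t (e j)]) tuple_weight t
  = \sum_(s | B s) tuple_weight s.
Proof.
move=> ei w1; rewrite (partition_big (fun t : {ffun J -> I} => [ffun j => t (e j)]) B)//=.
apply: eq_bigr => s Bs; rewrite -(sum_tuple_weight_fiber s ei w1).
by apply: eq_bigl => t; case: eqP => [->|]; rewrite ?Bs ?andbF.
Qed.

Lemma sum_tuple_weight (J : finType) :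
  \sum_i w i = 1 -> \sum_(t : {ffun J -> I}) tuple_weight t = 1.
Proof. by move=> w1; rewrite /tuple_weight -(bigA_distr_bigA (fun _ : J => w)) big1. Qed.

Lemma tuple_weight_ge0 (J : finType) (t : {ffun J -> I}) :
  (forall i, 0 <= w i) -> 0 <= tuple_weight t.
Proof. by move=> w0; rewrite prodr_ge0. Qed.

Definition ffun_pair (A B : finType) (p : {ffun A -> I} * {ffun B -> I}) :
    {ffun A + B -> I} :=
  [ffun j => match j with inl a => p.1 a | inr b => p.2 b end].

Lemma sum_ffun_pair (A B : finType) (P : pred {ffun A + B -> I}) :
  \sum_(t | P t) tuple_weight t
  = \sum_(p | P (ffun_pair p)) tuple_weight p.1 * tuple_weight p.2.
Proof.
rewrite (reindex (@ffun_pair A B))/=.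
  apply: eq_bigr => -[r s] _; rewrite /tuple_weight big_sumType/=.
  by congr (_ * _); apply: eq_bigr => j _; rewrite ffunE.
exists (fun t => ([ffun a => t (inl a)], [ffun b => t (inr b)])) => [[r s]|t] _.
  by congr pair; apply/ffunP => j; rewrite !ffunE.
by apply/ffunP => -[a|b]; rewrite !ffunE.
Qed.

End Weights.

(** The map sending [y] to [(m, y)], in the affine form that [convex_preimage] expects. *)
Definition slice_embed (R : realType) d (m : R) (y : 'rV[R]_d) : 'rV[R]_d.+1 :=
  y *m (row_mx 0 1%:M : 'M_(d, 1 + d)) + (row_mx m%:M 0 : 'rV_(1 + d)).

Definition slice (R : realType) d (m : R) (A : set 'rV[R]_d.+1) : set 'rV[R]_d :=
  slice_embed m @^-1` A.

Lemma slice_embedK (R : realType) d (x : 'rV[R]_d.+1) :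
  exists y, slice_embed (x 0 0) y = x.
Proof.
exists (rsubmx (x : 'rV_(1 + d))); rewrite /slice_embed.
rewrite mul_mx_row mulmx0 mulmx1 add_row_mx add0r addr0; apply: etrans (@hsubmxK _ 1 1 d x).
congr row_mx; apply/rowP => i; rewrite ord1 !mxE eqxx mulr1n.
by congr (x _ _); exact/val_inj.
Qed.

Lemma convex_meets_slice (R : realType) d (C : set 'rV[R]_d.+1) x y m :
  convex_set C -> C x -> C y -> x 0 0 <= m -> m <= y 0 0 -> slice m C !=set0.
Proof.
move=> cC Cx Cy xm my.
have fE (z : 'rV[R]_d.+1) : functional (delta_mx 0 0) z = z 0 0.
  by rewrite /functional -colE mxE.
have [||z Cz] := @convex_meets_level _ _ C (delta_mx 0 0) x y m cC Cx Cy; rewrite !fE// => <-.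
by have [y0 zy] := slice_embedK z; exists y0; rewrite /slice/= zy.
Qed.

Lemma finite_argmin (R : realType) (T : finType) (P : pred T) (f : T -> R) p0 :
  P p0 -> exists2 p, P p & forall q, P q -> f p <= f q.
Proof.
by move=> Pp0; exists [arg min_(p < p0 | P p) f p]%O; case: arg_minP => // p Pp; exact.
Qed.

(** An index type with 2^d elements, built so that a tuple over [cube d.+1] is a pair of tuples over
    [cube d]. *)
Fixpoint cube (d : nat) : finType :=
  if d is d'.+1 then (cube d' + cube d')%type else unit.

Definition meets (V : Type) (I J : Type) (K : I -> set V) (t : J -> I) : Prop :=
  \bigcap_j K (t j) !=set0.

(* A common point of the sets of a pair (r, s) of 2^d-tuples has first
   coordinate at least m r and m s, the least first coordinates of the recorded
   points of r and s; if m s <= m r, the sets of s meet in the slice x_0 = m r. *)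
Lemma fractional_helly (R : realType) d (I : finType) (w : I -> R)
    (K : I -> set 'rV[R]_d) (b : R) :
  (forall i, 0 <= w i) -> \sum_i w i = 1 -> (forall i, convex_set (K i)) ->
  (forall x, \sum_(i | `[< K i x >]) w i <= b) ->
  \sum_(t : {ffun cube d -> I} | `[< meets K t >]) tuple_weight w t <= 2 ^+ d * b.
Proof.
move=> w0 w1; elim: d K b => [|d IH] K b cK Kb.
  rewrite expr0 mul1r; apply: le_trans (Kb 0).
  rewrite (reindex (fun i => [ffun _ : cube 0 => i]))/=; last first.
    exists (fun t => t tt) => [i|t] _; first by rewrite ffunE.
    by apply/ffunP => -[]; rewrite ffunE.
  rewrite le_eqVlt; apply/orP; left; apply/eqP; apply: eq_big => i; last first.
    by rewrite /tuple_weight (big_pred1 tt) ?ffunE// => -[].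
  apply/asboolP/asboolP => [[x /(_ tt Logic.I)]|Ki]; first by rewrite ffunE (thinmx0 x).
  by exists 0 => -[] _; rewrite ffunE.
pose T := {ffun cube d -> I}.
pose cap (r : T) := \bigcap_j K (r j).
have ccap r : convex_set (cap r) by exact: convex_bigcap.
have capE (p : T * T) : meets K (ffun_pair p) <-> (cap p.1 `&` cap p.2) !=set0.
  split=> -[x xp]; exists x.
    by split=> j _; [have := xp (inl j) Logic.I|have := xp (inr j) Logic.I]; rewrite ffunE.
  by case: xp => x1 x2 -[] j _; rewrite ffunE; [exact: x1|exact: x2].
have [X XP] : {X : T * T -> 'rV[R]_d.+1 &
    forall p, meets K (ffun_pair p) -> (cap p.1 `&` cap p.2) (X p)}.
  apply: (@choice _ _ (fun p x => meets K (ffun_pair p) -> (cap p.1 `&` cap p.2) x)) => p.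
  by have [/capE[x]|nm] := pselect (meets K (ffun_pair p)); [exists x|exists 0].
have [m mP] : {m : T -> R & forall r p, cap r (X p) ->
    m r <= X p 0 0 /\ exists2 x, cap r x & x 0 0 = m r}.
  apply: (@choice _ _ (fun r m => forall p, cap r (X p) ->
    m <= X p 0 0 /\ exists2 x, cap r x & x 0 0 = m)) => r.
  have [[p rp]|nr] := pselect (exists p, cap r (X p)); last first.
    by exists 0 => p rp; exfalso; apply: nr; exists p.
  have [q /asboolP rq qmin] := @finite_argmin R (T * T)%type
    (fun p => `[< cap r (X p) >]) (fun p => X p 0 0) p (asboolT rp).
  exists (X q 0 0) => p' rp'; split; first by apply: qmin; exact/asboolP.
  by exists (X q).
pose G (r s : T) := `[< meets (fun i => slice (m r) (K i)) s >].
have GP (p : T * T) : meets K (ffun_pair p) -> G p.1 p.2 || G p.2 p.1.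
  case: p => r s /XP/= [rX sX].
  have [mr [x rx xr]] := mP r _ rX; have [ms [y sy ys]] := mP s _ sX.
  have [sr|/ltW rs] := leP (m s) (m r).
    apply/orP; left; apply/asboolP.
    by have [||z zP] := convex_meets_slice (ccap s) sy sX (m := m r); rewrite ?ys//; exists z.
  apply/orP; right; apply/asboolP.
  by have [||z zP] := convex_meets_slice (ccap r) rx rX (m := m s); rewrite ?xr//; exists z.
(* For fixed [r] the induction hypothesis in the slice [x_0 = m r] bounds the weight of the
   admissible [s]; then average over [r]. Exchanging [r] and [s] gives the second half, hence the
   factor 2 per dimension. *)
have half : \sum_(p : T * T | G p.1 p.2) tuple_weight w p.1 * tuple_weight w p.2 <= 2 ^+ d * b.
  rewrite -(pair_big_dep predT G (fun r s => tuple_weight w r * tuple_weight w s))/=.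
  rewrite -[leRHS]mul1r -[X in _ <= X * _](sum_tuple_weight (cube d) w1) mulr_suml.
  apply: ler_sum => r _.
  rewrite -mulr_sumr; apply: ler_wpM2l; first exact: tuple_weight_ge0.
  apply: (IH (fun i => slice (m r) (K i))) => [i|y]; first exact: convex_preimage.
  exact: Kb.
rewrite sum_ffun_pair.
apply: (@le_trans _ _ (\sum_(p : T * T | G p.1 p.2) tuple_weight w p.1 * tuple_weight w p.2
  + \sum_(p : T * T | G p.2 p.1) tuple_weight w p.1 * tuple_weight w p.2)).
  rewrite [leLHS]big_mkcond [X in X + _]big_mkcond [X in _ + X]big_mkcond -big_split/=.
  apply: ler_sum => p _; have p0 : 0 <= tuple_weight w p.1 * tuple_weight w p.2.
    by rewrite mulr_ge0// tuple_weight_ge0.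
  by case: asboolP => [/GP|_]; do 2 case: ifP => _ //=; lra.
have -> : \sum_(p : T * T | G p.2 p.1) tuple_weight w p.1 * tuple_weight w p.2
    = \sum_(p : T * T | G p.1 p.2) tuple_weight w p.1 * tuple_weight w p.2.
  rewrite (reindex (fun p : T * T => (p.2, p.1)))/=.
    by apply: eq_bigr => p _; rewrite mulrC.
  by exists (fun p : T * T => (p.2, p.1)) => -[].
by rewrite exprS -mulrA mulr_natl mulr2n lerD.
Qed.

(** Union bound: if all points were light, a random 2^d-tuple would meet with probability at most
    2^d / c. Every N-tuple meets along some injective choice [e] of positions, so the sum over all
    such [e] would be at least 1, against the choice of [c]. *)
Lemma heavy_point (R : realType) d N :
  exists2 c : nat, (0 < c)%N & forall (I : finType) (K : I -> set 'rV[R]_d) (w : I -> R),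
    (forall i, convex_set (K i)) ->
    (forall t : {ffun 'I_N -> I}, exists2 e : cube d -> 'I_N,
      injective e & meets K (fun j => t (e j))) ->
    (forall i, 0 <= w i) -> 0 < \sum_i w i ->
    exists x, \sum_i w i <= c%:R * \sum_(i | `[< K i x >]) w i.
Proof.
pose c := (#|{ffun cube d -> 'I_N}| * 2 ^ d).+1.
exists c => // I K w cK Kt w0 W0; set W := \sum_i w i in W0 *.
apply: contrapT => /forallNP hx.
pose v i := w i / W.
have v0 i : 0 <= v i by rewrite divr_ge0// ltW.
have v1 : \sum_i v i = 1 by rewrite -mulr_suml divff// gt_eqF.
have hv x : \sum_(i | `[< K i x >]) v i <= c%:R^-1.
  have /negP := hx x; rewrite -ltNge => h.
  rewrite -mulr_suml ler_pdivrMr// ler_pdivlMl// ltW//.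
have := fractional_helly v0 v1 cK hv.
set S := \sum_(t | _) _ => hS.
pose inj := [pred e : {ffun cube d -> 'I_N} | injectiveb e].
suff h : 1 <= \sum_(e | inj e) S.
  have : 1 <= #|{ffun cube d -> 'I_N}|%:R * S.
    apply: le_trans h _; rewrite sumr_const -[leLHS]mulr_natl ler_wpM2r ?ler_nat ?max_card//.
    by apply: sumr_ge0 => t _; exact: tuple_weight_ge0.
  apply/negP; rewrite -ltNge.
  apply: (@le_lt_trans _ _ (#|{ffun cube d -> 'I_N}|%:R * (2 ^+ d / c%:R))).
    exact: ler_wpM2l.
  by rewrite mulrA ltr_pdivrMr// mul1r -natrX -natrM ltr_nat.
rewrite -(sum_tuple_weight 'I_N v1).
have -> : \sum_(e | inj e) S = \sum_(e | inj e)
   \sum_(t : {ffun 'I_N -> I} | `[< meets K [ffun j => t (e j)] >]) tuple_weight v t.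
  apply: eq_bigr => e /injectiveP ei.
  by rewrite (sum_tuple_weight_marginal (fun s => `[< meets K s >]) ei v1).
rewrite (exchange_big_dep predT)//=; apply: ler_sum => t _.
have [e ei eK] := Kt t.
rewrite (bigD1 [ffun j => e j])/= ?lerDl ?sumr_ge0// => [_ _|].
  exact: tuple_weight_ge0.
apply/andP; split; first by apply/injectiveP => j k; rewrite !ffunE => /ei.
by apply/asboolP; case: eK => x xK; exists x => j _; rewrite !ffunE; exact: xK.
Qed.

(** * Fractional transversals and weak epsilon-nets *)

Lemma bernoulli_ineq (R : realType) (x : R) n : 0 <= x -> 1 + n%:R * x <= (1 + x) ^+ n.
Proof.
move=> x0; elim: n => [|n IH]; first by rewrite mul0r addr0.
have n0 : 0 <= n%:R :> R by [].
rewrite exprS mulrDl mul1r -[n.+1]addn1 natrD.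
have : x * 1 <= x * (1 + x) ^+ n by rewrite ler_wpM2l// exprn_ege1// lerDl.
lra.
Qed.

(* Multiplicative weights: start from unit weights, repeatedly record a heavy
   point and halve the weights of the sets containing it. *)
Lemma fractional_transversal (R : realType) (V : Type) (I : finType)
    (K : I -> set V) (c : nat) :
  I -> (0 < c)%N ->
  (forall w : I -> R, (forall i, 0 <= w i) -> 0 < \sum_i w i ->
     exists x, \sum_i w i <= c%:R * \sum_(i | `[< K i x >]) w i) ->
  exists2 xs : seq V, (0 < size xs)%N &
    forall i, (size xs <= 6 * c * count (fun x => `[< K i x >]) xs)%N.
Proof.
move=> i0 c0 heavy.
pose hits i xs := count (fun x => `[< K i x >]) xs.
pose w xs i : R := 2^-1 ^+ hits i xs.
have w_gt0 xs i : 0 < w xs i by rewrite exprn_gt0.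
have c0R : 0 < c%:R :> R by rewrite ltr0n.
have cge1 : 1 <= c%:R :> R by rewrite ler1n.
(* A heavy point carries at least a fraction 1/c of the weight, and half of that is lost, so [a]
   bounds the decay per step. *)
pose a : R := 1 - (2 * c%:R)^-1.
have a0 : 0 <= a.
  by rewrite /a subr_ge0 invf_le1; lra.
have run T : exists2 xs, size xs = T & \sum_i w xs i <= a ^+ T * #|I|%:R.
  elim: T => [|T [xs sxs hxs]].
    by exists [::] => //; rewrite expr0 mul1r /w/= sumr_const.
  have [||x hx] := heavy (w xs); first by move=> i; exact: ltW.
    by rewrite (bigD1 i0)//= ltr_pwDl// sumr_ge0// => i _; exact: ltW.
  exists (x :: xs) => /=; first by rewrite sxs.
  have -> : \sum_i w (x :: xs) i
      = \sum_i w xs i - 2^-1 * \sum_(i | `[< K i x >]) w xs i.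
    rewrite mulr_sumr [X in _ - X]big_mkcond -sumrB; apply: eq_bigr => i _.
    rewrite /w /hits/=; case: asboolP => _ /=; last by rewrite subr0 add0n.
    by rewrite add1n exprS; field.
  rewrite exprS -mulrA; apply: le_trans (ler_wpM2l a0 hxs).
  rewrite /a mulrBl mul1r lerD2l lerN2 invfM -mulrA ler_wpM2l//.
  by rewrite ler_pdivrMl.
(* With y = 1/(2c), (1 - y)(1 + y) <= 1 and Bernoulli gives (1 + y)^(6c) >= 1 + 3. *)
have a4 : a ^+ (6 * c) <= 4^-1.
  have h : a ^+ (6 * c) * (1 + (2 * c%:R)^-1) ^+ (6 * c) <= 1.
    rewrite -exprMn exprn_ile1//.
      by rewrite mulr_ge0// addr_ge0// invr_ge0; lra.
    by rewrite /a -subr_sqr expr1n lerBlDr lerDl sqr_ge0.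
  have := @bernoulli_ineq R (2 * c%:R)^-1 (6 * c) _.
  have -> : (6 * c)%:R * (2 * c%:R)^-1 = 3 :> R by rewrite natrM; field; lra.
  rewrite invr_ge0 => /(_ _)/wrap[]; first lra.
  move=> h1; have : 0 <= a ^+ (6 * c) by rewrite exprn_ge0.
  nra.
(* After [6 * c * u] steps the total weight is at most 4^-u * #|I| <= 2^-u, so each set has been hit
   at least [u] times. *)
pose u := #|I|.+1.
have [xs sxs hxs] := run (6 * c * u)%N.
exists xs; first by rewrite sxs !muln_gt0 c0.
move=> i; rewrite sxs leq_mul2l; apply/orP; right.
suff : w xs i <= 2^-1 ^+ u.
  by rewrite /w ler_iXn2l//; lra.
have -> : (2^-1 : R) ^+ u = 4^-1 ^+ u * 2 ^+ u.
  by rewrite -exprMn; congr (_ ^+ _); field.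
apply: (@le_trans _ _ (\sum_i w xs i)).
  by rewrite (bigD1 i)//= lerDl sumr_ge0// => j _; exact: ltW.
apply: le_trans hxs _; rewrite exprM; apply: ler_pM => //.
- by rewrite exprn_ge0// exprn_ge0.
- by rewrite lerXn2r// ?nnegrE ?exprn_ge0.
- by rewrite -natrX ler_nat ltnW// ltnW// (leq_trans (ltn_expl u (leqnn 2))).
Qed.

(** Take the least value of [f] whose lower set carries half the weight; the next smaller value, if
    any, fails this. *)
Lemma weighted_median (R : realType) (J : finType) (w f : J -> R) :
  J -> (forall j, 0 <= w j) ->
  exists m, \sum_(j | f j < m) w j <= (\sum_j w j) / 2 /\
            \sum_(j | m < f j) w j <= (\sum_j w j) / 2.
Proof.
move=> j0 w0; set W := \sum_j w j.
have W0 : 0 <= W by exact: sumr_ge0.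
pose P j := W / 2 <= \sum_(k | f k <= f j) w k.
have [jm _ hm] := @finite_argmin R J predT (fun j => - f j) j0 isT.
have Pm : P jm.
  rewrite /P (eq_bigl predT) => [|k]; first by rewrite -/W; lra.
  by have := hm k isT; rewrite lerN2 => ->.
have [j Pj hj] := @finite_argmin R J P f jm Pm.
exists (f j); split; last first.
  move: Pj; rewrite /P; rewrite /W in W0 *; rewrite (bigID (fun k => f k <= f j))/=.
  under [X in _ + X]eq_bigl do rewrite -ltNge.
  lra.
have [[k kj]|nk] := pselect (exists k, f k < f j); last first.
  rewrite big_pred0; first by rewrite divr_ge0.
  by move=> k; apply/negP => kj; apply: nk; exists k.
have [q qj hq] := @finite_argmin R J (fun k => f k < f j) (fun k => - f k) k kj.
have /negP : ~ P q by move=> /hj; rewrite leNgt qj.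
rewrite -ltNge => /ltW; apply: le_trans; rewrite le_eqVlt; apply/orP; left; apply/eqP.
apply: eq_bigl => l; apply/idP/idP => [lj|lq]; last exact: le_lt_trans lq qj.
by have := hq l lj; rewrite lerN2.
Qed.

(** To make [z] independent of [C], the slice is taken in the intersection of all convex sets
    containing [x] and [y]. *)
Lemma segment_meets_slice (R : realType) d (x y : 'rV[R]_d.+1) m :
  x 0 0 <= m -> m <= y 0 0 ->
  exists z, forall C, convex_set C -> C x -> C y -> slice m C z.
Proof.
move=> xm my.
pose S : set 'rV[R]_d.+1 := [set z | forall C, convex_set C -> C x -> C y -> C z].
have cS : convex_set S.
  apply/convex_setP => u v t t0 t1 Su Sv C cC Cx Cy.
  by move/convex_setP: (cC); apply=> //; [exact: Su|exact: Sv].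
have [||z Sz] := @convex_meets_slice R d S x y m cS _ _ xm my; try by move=> C _.
by exists z => C cC Cx Cy; exact: Sz.
Qed.

(* Halve the points by a hyperplane x_0 = m.  A convex set with many points on
   both sides contains many crossing points of segments with the hyperplane and
   is met by a net of the lower dimension; otherwise one side carries 3/4 of
   its weight, so that its density there is multiplied by at least 3/2. *)
Lemma weak_epsilon_net (R : realType) d (eps : R) : 0 < eps ->
  exists n : nat, forall (J : finType) (p : J -> 'rV[R]_d) (w : J -> R),
    (forall j, 0 <= w j) ->
    exists2 X : seq 'rV[R]_d, (size X <= n)%N &
      forall C : set 'rV[R]_d, convex_set C ->
        0 < \sum_(j | `[< C (p j) >]) w j ->
        eps * \sum_j w j <= \sum_(j | `[< C (p j) >]) w j ->
        exists2 x, x \in X & C x.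
Proof.
elim: d eps => [|d IH] eps eps0.
  exists 1%N => J p w w0; exists [:: 0] => // C cC C0 _; exists 0; rewrite ?inE//.
  have [[j Cj]|nC] := pselect (exists j, C (p j)); first by rewrite -(thinmx0 (p j)).
  by move: C0; rewrite big_pred0 ?ltxx// => j; apply/asboolP => Cj; apply: nC; exists j.
(* A density never exceeds 1, so [k] bounds how often it can grow by a factor 3/2; the inner
   induction is on [k]. *)
have [k hk] : exists k, 1 < (3 / 2) ^+ k * eps.
  have [k hk] : exists k : nat, eps^-1 < k%:R.
    by exists (Num.truncn eps^-1).+1; rewrite truncnS_gt.
  exists (2 * k)%N; rewrite -ltr_pdivrMr// div1r; apply: lt_le_trans hk _.
  have -> : 3 / 2 = 1 + 2^-1 :> R by field.
  apply: le_trans (bernoulli_ineq _ _); last by rewrite invr_ge0.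
  by rewrite natrM mulrAC divff// mul1r lerDr.
elim: k eps eps0 hk => [|k IHk] eps eps0 hk.
  exists 0%N => J p w w0; exists [::] => // C cC C0 hC; exfalso.
  have CW : \sum_(j | `[< C (p j) >]) w j <= \sum_j w j.
    by rewrite [leRHS](bigID (fun j => `[< C (p j) >]))/= lerDl sumr_ge0.
  by move: hk; rewrite expr0 mul1r; nra.
(* Density of crossing pairs when [C] has at least [eps / 4] of the weight on each side. *)
have [n0 h0] := IH (eps ^+ 2 / 16) ltac:(by rewrite divr_gt0// exprn_gt0).
have [n1 h1] := IHk (3 / 2 * eps) ltac:(by rewrite mulr_gt0// divr_gt0)
  ltac:(by rewrite mulrA -exprSr).
exists (n0 + (n1 + n1))%N => J p w w0.
case: (pickP (@predT J)) => [j0 _|nJ]; last first.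
  by exists [::] => // C _; rewrite big_pred0 ?ltxx// => j; have := nJ j.
have [m [hL hG]] := weighted_median (fun j => p j 0 0) j0 w0.
set W := \sum_j w j in hL hG.
have W0 : 0 <= W by exact: sumr_ge0.
have [q hq] : {q : J * J -> 'rV[R]_d & forall j, p j.1 0 0 <= m -> m <= p j.2 0 0 ->
    forall C, convex_set C -> C (p j.1) -> C (p j.2) -> slice m C (q j)}.
  apply: (@choice _ _ (fun (j : J * J) z => p j.1 0 0 <= m -> m <= p j.2 0 0 ->
    forall C, convex_set C -> C (p j.1) -> C (p j.2) -> slice m C z)) => j.
  have [jm|jm] := pselect (p j.1 0 0 <= m); last by exists 0 => /jm.
  have [mj|mj] := pselect (m <= p j.2 0 0); last by exists 0 => _ /mj.
  by have [z hz] := segment_meets_slice jm mj; exists z.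
pose restr (P : pred J) j := if P j then w j else 0.
have restr0 P j : 0 <= restr P j by rewrite /restr; case: ifP.
pose le j := p j 0 0 <= m; pose ge j := m <= p j 0 0.
(* The median bounds only the strict sides by half the weight; the closed sides supply the crossing
   segments. *)
pose lt j := p j 0 0 < m; pose gt j := m < p j 0 0.
have [X0 sX0 hX0] := h0 _ q (fun j => restr le j.1 * restr ge j.2)
  (fun j => mulr_ge0 (restr0 _ _) (restr0 _ _)).
have [X1 sX1 hX1] := h1 J p (restr lt) (restr0 _).
have [X2 sX2 hX2] := h1 J p (restr gt) (restr0 _).
exists (map (slice_embed m) X0 ++ (X1 ++ X2)).
  by rewrite !size_cat size_map leq_add// leq_add.
move=> C cC C0; rewrite -/W => hC.
set A := \sum_(j | _) w j in C0 hC.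
pose part P := \sum_(j | `[< C (p j) >]) restr P j.
have partC P Q : (forall j, P j = ~~ Q j) -> A = part P + part Q.
  move=> PQ; rewrite /A /part -big_split; apply: eq_bigr => j _ /=.
  by rewrite /restr PQ; case: (Q j); rewrite ?add0r ?addr0.
have A1 : A = part lt + part ge by apply: partC => j; rewrite /lt /ge ltNge.
have A2 : A = part gt + part le by apply: partC => j; rewrite /gt /le ltNge.
have sumlt : \sum_j restr lt j <= W / 2 by rewrite /restr -big_mkcond.
have sumgt : \sum_j restr gt j <= W / 2 by rewrite /restr -big_mkcond.
have sumle P : \sum_j restr P j <= W.
  by apply: ler_sum => j _; rewrite /restr; case: ifP.
have Wgt0 : 0 < W.
  apply: lt_le_trans C0 _.
  by rewrite /W [leRHS](bigID (fun j => `[< C (p j) >]))/= lerDl sumr_ge0.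
have eW : 0 < eps * W by rewrite mulr_gt0.
have [gelt|gege] := ltP (part ge) (eps / 4 * W).
  have [||x xX Cx] := hX1 C cC; rewrite -/(part lt).
  - by lra.
  - apply: (@le_trans _ _ (3 / 2 * eps * (W / 2))); last lra.
    by apply: ler_wpM2l => //; lra.
  by exists x => //; rewrite !mem_cat xX orbT.
have [lelt|lege] := ltP (part le) (eps / 4 * W).
  have [||x xX Cx] := hX2 C cC; rewrite -/(part gt).
  - by lra.
  - apply: (@le_trans _ _ (3 / 2 * eps * (W / 2))); last lra.
    by apply: ler_wpM2l => //; lra.
  by exists x => //; rewrite !mem_cat xX !orbT.
have prod : part le * part ge
    <= \sum_(j | `[< slice m C (q j) >]) restr le j.1 * restr ge j.2.
  rewrite /part big_distrl/=; under eq_bigr do rewrite big_distrr/=.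
  rewrite pair_big/= big_mkcond [leRHS]big_mkcond; apply: ler_sum => j _.
  case: ifP => [/andP[/asboolP Cj1 /asboolP Cj2]|_]; last first.
    by case: ifP => // _; exact: mulr_ge0.
  case: ifPn => // /asboolP nq; rewrite /restr.
  case: ifP => [jm|_]; last by rewrite mul0r.
  case: ifP => [mj|_]; last by rewrite mulr0.
  by exfalso; apply: nq; exact: hq.
have pp : (eps / 4 * W) * (eps / 4 * W) <= part le * part ge.
  by apply: ler_pM => //; lra.
have [|||x xX Cx] := hX0 (slice m C).
- exact: convex_preimage.
- by apply: lt_le_trans prod; apply: lt_le_trans pp; apply: mulr_gt0; lra.
- apply: le_trans prod; apply: le_trans pp.
  have -> : \sum_j restr le j.1 * restr ge j.2 = (\sum_j restr le j) * \sum_j restr ge j.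
    rewrite big_distrl/=; under [RHS]eq_bigr do rewrite big_distrr/=.
    by rewrite pair_big.
  have -> : eps / 4 * W * (eps / 4 * W) = eps ^+ 2 / 16 * (W * W) by field.
  apply: ler_wpM2l; first by rewrite divr_ge0// exprn_ge0// ltW.
  by apply: ler_pM => //; apply: sumr_ge0.
by exists (slice_embed m x) => //; rewrite mem_cat map_f.
Qed.

(** If every N-tuple contains a meeting 2^d-subtuple, heavy points exist for all weights, hence a
    list of points of which each set contains a fixed fraction; a weak net for that list pierces
    every set. *)
Lemma pq_theorem (R : realType) d N :
  exists f : nat, forall (I : finType) (K : I -> set 'rV[R]_d),
    (forall i, convex_set (K i)) ->
    (exists2 X : seq 'rV[R]_d, (size X <= f)%N &
       forall i, exists2 x, x \in X & K i x) \/
    (exists t : {ffun 'I_N -> I}, forall e : cube d -> 'I_N,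
       injective e -> ~ meets K (fun j => t (e j))).
Proof.
have [c c0 heavy] := heavy_point R d N.
have c0R : 0 < (6 * c)%:R^-1 :> R by rewrite invr_gt0 ltr0n muln_gt0 c0.
have [f net] := weak_epsilon_net d c0R.
exists f => I K cK.
have [[t ht]|/forallNP nt] := pselect (exists t : {ffun 'I_N -> I},
  forall e : cube d -> 'I_N, injective e -> ~ meets K (fun j => t (e j))).
  by right; exists t.
left.
case: (pickP (@predT I)) => [i0 _|nI]; last by exists [::] => // i; have := nI i.
have [w w0 W0|xs xs0 hxs] := fractional_transversal (K := K) (R := R) i0 c0.
  apply: heavy => // t; apply: contrapT => /forall2NP ht; apply: (nt t) => e ei eK.
  by have [/(_ ei)|/(_ eK)] := ht e.
(* Indexing by positions in [xs] counts repeated points with multiplicity. *)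
have [X sX hX] := net _ (tnth (in_tuple xs)) (fun _ => 1) (fun _ => ler01).
exists X => // i.
have countE : \sum_(j < size xs | `[< K i (tnth (in_tuple xs) j) >]) 1
    = (count (fun x => `[< K i x >]) xs)%:R :> R.
  by rewrite -sum1_count [in RHS]big_tnth natr_sum.
have := hxs i; set n := count _ _ => hn.
apply: hX => //; rewrite countE -/n.
  rewrite ltr0n; case: posnP hn => // ->; rewrite muln0 leqn0 => /eqP.
  by case: (size xs) xs0.
rewrite sumr_const card_ord mulrC ler_pdivrMr ?ltr0n ?muln_gt0 ?c0//.
by rewrite -natrM ler_nat mulnC.
Qed.

(** * Crossing by lines *)

Lemma pigeonhole_fiber (A B : finType) (f : A -> B) M :
  (M * #|B| < #|A|)%N ->
  exists b, exists2 g : 'I_M -> A, injective g & forall i, f (g i) = b.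
Proof.
move=> AB.
have [b hb] : exists b, (M <= #|[pred a | f a == b]|)%N.
  apply: contrapT => /forallNP hf; move: AB; apply/negP; rewrite -leqNgt.
  rewrite -sum1_card (partition_big f predT)//= mulnC -sum_nat_const.
  apply: leq_sum => b _; rewrite sum1_card ltnW// ltnNge.
  by apply/negP; exact: hf.
exists b, (fun i => enum_val (widen_ord hb i)).
  by move=> i j /enum_val_inj /(congr1 val)/= /val_inj.
by move=> i; have := enum_valP (widen_ord hb i); rewrite inE => /eqP.
Qed.

Definition ffun_cons (T : Type) k (b : T) (c : 'I_k -> T) : {ffun 'I_k.+1 -> T} :=
  [ffun j => if unlift ord0 j is Some j' then c j' else b].

(** For each value [b] of the first coordinate, induction gives a monochromatic box in the others.
    There are finitely many outcomes (box and color), so [M] values of [b] share one. *)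
Lemma product_ramsey k M q :
  exists N, forall chi : {ffun 'I_k -> 'I_N} -> 'I_q,
    exists e : {ffun 'I_k -> {ffun 'I_M -> 'I_N}},
      (forall j, injective (e j)) /\
      exists a, forall c : {ffun 'I_k -> 'I_M}, chi [ffun j => e j (c j)] = a.
Proof.
elim: k => [|k [N0 IH]].
  exists M => chi; exists [ffun _ => [ffun x => x]]; split=> [[]//|].
  exists (chi [ffun j => widen_ord (leq0n M) j]) => c.
  by congr chi; apply/ffunP => -[].
pose T := ({ffun 'I_k -> {ffun 'I_M -> 'I_N0}} * 'I_q)%type.
pose n1 := (M * #|{: T}|).+1.
exists (N0 + n1)%N => chi.
have [out outP] : {out : 'I_(N0 + n1) -> T & forall b,
    (forall j, injective ((out b).1 j)) /\
    forall c : {ffun 'I_k -> 'I_M},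
      chi (ffun_cons b (fun j => lshift n1 ((out b).1 j (c j)))) = (out b).2}.
  apply: (@choice _ _ (fun b (o : T) => (forall j, injective (o.1 j)) /\
    forall c : {ffun 'I_k -> 'I_M},
      chi (ffun_cons b (fun j => lshift n1 (o.1 j (c j)))) = o.2)) => b.
  have [e [ei [a ea]]] := IH (fun c => chi (ffun_cons b (fun j => lshift n1 (c j)))).
  exists (e, a); split=> // c /=; rewrite -(ea c); congr chi.
  by apply/ffunP => j; rewrite !ffunE; case: unliftP => // j' _; rewrite ffunE.
have [|[e a] [g gi gP]] := @pigeonhole_fiber _ _ out M.
  by rewrite card_ord /n1 ltn_addl.
exists (ffun_cons [ffun x => g x] (fun j => [ffun x => lshift n1 (e j x)])); split.
  move=> j x y; rewrite !ffunE; case: unliftP => [j'|] _; rewrite !ffunE; last exact: gi.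
  by have [ei _] := outP (g x); rewrite gP in ei => /lshift_inj/ei.
exists a => c.
have [_ /(_ [ffun j => c (lift ord0 j)])] := outP (g (c ord0)).
rewrite gP/= => <-; congr chi; apply/ffunP => j; rewrite !ffunE.
by case: unliftP => [j' ->|->]; rewrite !ffunE.
Qed.

(** * Descent through hyperplanes to lines *)

Lemma leq_size_flatten (T : finType) (U : Type) (f : T -> seq U) n :
  (forall x, (size (f x) <= n)%N) ->
  (size (flatten [seq f x | x <- enum T]) <= #|T| * n)%N.
Proof.
move=> fn; rewrite cardE; elim: (enum T) => //= x s IHs.
by rewrite size_cat mulSn leq_add.
Qed.

(* The first class has no common point, so the intersection of C i with any
   selection c from the other classes meets one of boundedly many hyperplanes.
   By Ramsey's theorem the hyperplane does not depend on c after passing to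
   large subclasses, and we continue inside that hyperplane. *)
Lemma crossing_lines (R : realType) (Q : finType) k :
  exists N g, forall (S : 'I_k -> 'I_N -> set 'rV[R]_k.+1) (I : finType)
      (C : I -> set 'rV[R]_k.+1),
    (forall j b, convex_set (S j b)) -> (forall i, convex_set (C i)) ->
    (forall j (e : Q -> 'I_N), injective e -> ~ meets (S j) e) ->
    (forall i (c : 'I_k -> 'I_N), C i `&` \bigcap_j S j (c j) !=set0) ->
    exists2 L : seq ('rV[R]_k.+1 * 'rV[R]_k.+1), (size L <= g)%N &
      forall i, exists2 l, l \in L & exists t, C i (l.1 + t *: l.2).
Proof.
elim: k => [|k [N0 [g0 IH]]].
  exists 0%N, 1%N => S I C _ _ _ SC; exists [:: (0, const_mx 1)] => // i.
  have [x [Cx _]] := SC i (fun j => j).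
  exists (0, const_mx 1); rewrite ?inE//; exists (x 0 0) => /=.
  suff -> : 0 + x 0 0 *: const_mx 1 = x by [].
  by apply/rowP => j; rewrite !mxE ord1 add0r mulr1.
have [N1 ramsey] := product_ramsey k N0 #|Q|.
pose T := ('I_#|Q| * {ffun 'I_k -> {ffun 'I_N0 -> 'I_N1}})%type.
(* The last [#|Q|] sets of the first class produce the hyperplanes, the first [N1] sets of each
   other class feed Ramsey; each outcome in [T] costs at most [g0] lines. *)
exists (N1 + #|Q|)%N, (#|{: T}| * g0)%N => S I C cS cC SN SC.
pose e0 (x : Q) : 'I_(N1 + #|Q|) := rshift N1 (enum_rank x).
have e0i : injective e0 by move=> x y /rshift_inj/enum_rank_inj.
have e0N := SN ord0 e0 e0i.
pose D i (c : {ffun 'I_k -> 'I_N1}) :=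
  C i `&` \bigcap_j S (lift ord0 j) (lshift #|Q| (c j)).
have cD i c : convex_set (D i c).
  by apply: convex_setI => //; apply: convex_bigcap => j.
have DS i c x : D i c `&` S ord0 (e0 x) !=set0.
  have [z [Cz Sz]] := SC i (ffun_cons (e0 x) (fun j => lshift #|Q| (c j))).
  exists z; split; last by have := Sz ord0 Logic.I; rewrite ffunE unlift_none.
  by split=> // j _; have := Sz (lift ord0 j) Logic.I; rewrite ffunE liftK.
have [x0 _] : exists x0 : Q, True.
  apply: contrapT => nQ; apply: e0N; exists 0 => x _.
  by exfalso; apply: nQ; exists x.
(* The list [h] depends on [S] only, so it serves all [i] and all selections at once. *)
have [||x _|h hs hD] := @separating_hyperplanes R k.+2 Q
    (fun x => S ord0 (e0 x)) (enum Q) setT.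
- by move=> x; exact: cS.
- by apply/convex_setP.
- apply: contrapT => nx; apply: e0N; exists x => y _; apply: contrapT => ny.
  by apply: nx; exists y; rewrite ?mem_enum.
pose u (a : 'I_#|Q|) := (nth (0, 0) h a).1.
pose b (a : 'I_#|Q|) := (nth (0, 0) h a).2.
have hDa i c : exists a : 'I_#|Q|, u a != 0 /\ exists2 z, D i c z & functional (u a) z = b a.
  have [||//|y _|a aQ ha] := hD (D i c).
  - exact: cD.
  - by have [z [Dz _]] := DS i c x0; exists z.
  - exact: DS.
  by rewrite -cardE in aQ; exists (Ordinal aQ).
have [chi chiP] : {chi : I * {ffun 'I_k -> 'I_N1} -> 'I_#|Q| & forall p,
    u (chi p) != 0 /\ exists2 z, D p.1 p.2 z & functional (u (chi p)) z = b (chi p)}.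
  apply: (@choice _ _ (fun p a => u a != 0 /\
    exists2 z, D p.1 p.2 z & functional (u a) z = b a)) => p.
  exact: hDa.
have [out outP] : {out : I -> T & forall i,
    (forall j, injective ((out i).2 j)) /\
    forall c : {ffun 'I_k -> 'I_N0},
      chi (i, [ffun j => (out i).2 j (c j)]) = (out i).1}.
  apply: (@choice _ _ (fun i (o : T) => (forall j, injective (o.2 j)) /\
    forall c : {ffun 'I_k -> 'I_N0}, chi (i, [ffun j => o.2 j (c j)]) = o.1)) => i.
  have [e [ei [a ea]]] := ramsey (fun c => chi (i, c)).
  by exists (a, e).
have [Lf LfP] : {Lf : T -> seq ('rV[R]_k.+2 * 'rV[R]_k.+2) & forall o,
    (size (Lf o) <= g0)%N /\ forall i, out i = o ->
      exists2 l, l \in Lf o & exists t, C i (l.1 + t *: l.2)}.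
  apply: (@choice _ _ (fun (o : T) (L : seq ('rV[R]_k.+2 * 'rV[R]_k.+2)) =>
    (size L <= g0)%N /\ forall i, out i = o ->
      exists2 l, l \in L & exists t, C i (l.1 + t *: l.2))) => o.
  have [[i0 oi0]|no] := pselect (exists i, out i = o); last first.
    by exists [::]; split=> // i oi; exfalso; apply: no; exists i.
  have [oi _] := outP i0; rewrite {}oi0 in oi.
  (* That [u o.1] is nonzero is learnt only from a selection [c], and ['I_N0] might be empty; hence
     the guarded form. *)
  have [M [p Mp]] : exists (M : 'M[R]_(k.+1, k.+2)) (p : 'rV[R]_k.+2), u o.1 != 0 ->
      forall x, functional (u o.1) x = b o.1 -> exists y, x = y *m M + p.
    have [u0|uN0] := eqVneq (u o.1) 0; first by exists 0, 0.
    by have [M [p Mp]] := hyperplane_param (b o.1) uN0; exists M, p.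
  pose pre (A : set 'rV[R]_k.+2) := (fun y : 'rV_k.+1 => y *m M + p) @^-1` A.
  have [||||L sL hL] := IH
      (fun j x => pre (S (lift ord0 j) (lshift #|Q| (o.2 j x))))
      {i | out i == o} (fun i => pre (C (val i))).
  - by move=> j x; exact: convex_preimage.
  - by move=> i; exact: convex_preimage.
  - move=> j e ei [y Sy]; apply: (SN (lift ord0 j) (fun x => lshift #|Q| (o.2 j (e x)))).
      by move=> x x' /lshift_inj/oi/ei.
    by exists (y *m M + p) => x _; exact: (Sy x).
  - move=> [i /= /eqP io] c; have [_ /(_ [ffun j => c j])] := outP i; rewrite io.
    set c' := finfun _ => hc.
    have [uN0 [z [Cz Sz] uz]] := chiP (i, c'); rewrite hc in uN0 uz.
    have [y zy] := Mp uN0 z uz.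
    exists y; split=> [|j _]; rewrite /pre/= -zy//.
    by have := Sz j Logic.I; rewrite !ffunE.
  exists [seq (l.1 *m M + p, l.2 *m M) | l <- L]; split; first by rewrite size_map.
  move=> i /eqP oi'; have [l lL [t Ct]] := hL (exist _ i oi').
  exists (l.1 *m M + p, l.2 *m M); first exact: (map_f (fun l => (l.1 *m M + p, l.2 *m M))).
  exists t; move: Ct; rewrite /pre/=; congr (C i _).
  by rewrite mulmxDl -scalemxAl addrAC.
exists (flatten [seq Lf o | o <- enum {: T}]).
  by apply: leq_size_flatten => o; case: (LfP o).
move=> i; have [_ /(_ i erefl)[l lL hl]] := LfP (out i).
by exists l => //; apply/flatten_mapP; exists (out i); rewrite ?mem_enum.
Qed.

Lemma card_le_seq (T : choiceType) (s : seq T) n :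
  (size s <= n)%N -> ([set` s] #<= `I_n)%card.
Proof.
case: s => [|x s] sn; first by rewrite set_nil card_ge0.
apply: (@card_le_trans _ _ _ (nth x (x :: s) @` `I_n)); last exact: card_image_le.
apply: subset_card_le => y /= ys; exists (index y (x :: s)); last exact: nth_index.
by apply: leq_trans sn; rewrite index_mem.
Qed.

Unset Implicit Arguments.

Theorem theorem6 (R : realType) (d : nat) (hd : (2 <= d)%N) :
  exists f g : nat,
    forall F : 'I_d.+1 -> set (set 'rV[R]_d),
      (forall j, finite_set (F j)) ->
      (forall j K, F j K -> convex_set K) ->
      colorful_helly F ->
      forall i : 'I_d.+1,
        F i !=set0 ->
        \bigcap_(K in F i) K !=set0 ->
        (exists2 j : 'I_d.+1, j != i & pierced_by_points f (F j)) \/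
        crossed_by_lines g (\bigcup_j F j).
Proof.
case: d hd => [//|k] _.
have [N [g0 hlines]] := @crossing_lines R (cube k.+1) k.
have [f pq] := @pq_theorem R k.+1 N.
(* At most [g0] lines for each of the [k.+1] colors other than [i], plus one through [p0] for color
   [i]. *)
exists f, (k.+1 * g0).+1 => F finF cF chF i [B FB] [p0 p0F].
have [[j ji Fj]|nF] := pselect (exists2 j, j != i & pierced_by_points f (F j)).
  by left; exists j.
right.
have [s sF] : {s : 'I_k.+2 -> seq (set 'rV[R]_k.+1) & forall j, F j = [set` s j]}.
  apply: (@choice _ _ (fun j s => F j = [set` s])) => j.
  by have /finite_seqP := finF j.
have inF j (x : 'I_(size (s j))) : F j (tnth (in_tuple (s j)) x).
  by rewrite sF /= mem_tnth.
have [S SP] : {S : 'I_k.+1 -> 'I_N -> set 'rV[R]_k.+1 & forall j,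
    (forall b, F (lift i j) (S j b)) /\
    forall e : cube k.+1 -> 'I_N, injective e -> ~ meets (S j) e}.
  apply: (@choice _ _ (fun j (S : 'I_N -> set 'rV[R]_k.+1) =>
    (forall b, F (lift i j) (S b)) /\
    forall e : cube k.+1 -> 'I_N, injective e -> ~ meets S e)) => j.
  have [x|[X sX hX]|[t ht]] := pq _ (tnth (in_tuple (s (lift i j)))).
  - exact: cF (inF _ x).
  - exfalso; apply: nF; exists (lift i j); first by rewrite eq_sym neq_lift.
    exists [set` X]; split; first exact: card_le_seq.
    move=> K; rewrite sF => /= Ks.
    have /tnthP[x ->] : K \in in_tuple (s (lift i j)) by [].
    by have [y yX Ky] := hX x; exists y.
  - by exists (fun b => tnth (in_tuple (s (lift i j))) (t b)).
have [L LP] : {L : 'I_k.+1 -> seq ('rV[R]_k.+1 * 'rV[R]_k.+1) & forall j,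
    (size (L j) <= g0)%N /\ forall K, F (lift i j) K ->
      exists2 l, l \in L j & exists t, K (l.1 + t *: l.2)}.
  apply: (@choice _ _ (fun j (L : seq ('rV[R]_k.+1 * 'rV[R]_k.+1)) =>
    (size L <= g0)%N /\ forall K, F (lift i j) K ->
      exists2 l, l \in L & exists t, K (l.1 + t *: l.2))) => j.
  have [||||L sL hL] := hlines (fun l => S (lift j l)) _ (tnth (in_tuple (s (lift i j)))).
  - by move=> l b; have [/(_ b)/cF] := SP (lift j l).
  - by move=> x; exact: cF (inF _ x).
  - by move=> l; have [] := SP (lift j l).
  - move=> x c.
    (* A rainbow selection: [B] for color [i], the set to be crossed for color [lift i j], and the
       sets picked by [c] for the remaining colors. *)
    pose sel l := if unlift i l is Some l' then
        if unlift j l' is Some l'' then S (lift j l'') (c l'')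
        else tnth (in_tuple (s (lift i j))) x
      else B.
    have [l|z hz] := chF sel.
      rewrite /sel; case: unliftP => [l'|] -> //; case: unliftP => [l''|] -> //.
      by have [/(_ (c l''))] := SP (lift j l'').
    exists z; split; first by have := hz (lift i j) Logic.I; rewrite /sel liftK unlift_none.
    by move=> l _; have := hz (lift i (lift j l)) Logic.I; rewrite /sel !liftK.
  exists L; split=> // K; rewrite sF => /= Ks.
  have /tnthP[x ->] : K \in in_tuple (s (lift i j)) by [].
  exact: hL.
pose v0 : 'rV[R]_k.+1 := const_mx 1.
have v0N0 : v0 != 0.
  by apply/eqP => /rowP/(_ ord0)/eqP; rewrite !mxE oner_eq0.
(* Degenerate lines, with direction 0, get an arbitrary direction instead. *)
pose line (l : 'rV[R]_k.+1 * 'rV[R]_k.+1) : set 'rV[R]_k.+1 :=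
  [set l.1 + t *: (if l.2 == 0 then v0 else l.2) | t in [set: R]].
have lineP (l : 'rV[R]_k.+1 * 'rV[R]_k.+1) t : line l (l.1 + t *: l.2).
  rewrite /line/=; case: eqP => [->|_]; last by exists t.
  by exists 0 => //; rewrite scale0r scaler0.
exists [set` map line ((p0, 0) :: flatten [seq L j | j <- enum 'I_k.+1])]; split.
- apply: card_le_seq; rewrite size_map /= ltnS -[X in (_ <= X * _)%N]card_ord.
  by apply: leq_size_flatten => j; case: (LP j).
- move=> _ /mapP[l _ ->]; exists l.1, (if l.2 == 0 then v0 else l.2); split=> //.
  by case: ifPn.
- move=> K [j _ FjK]; case: (unliftP i j) FjK => [j'|] -> FK.
    have [_ /(_ K FK)[l lL [t Kt]]] := LP j'.
    exists (line l); last by exists (l.1 + t *: l.2).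
    apply: map_f; rewrite inE; apply/orP; right.
    by apply/flatten_mapP; exists j'; rewrite ?mem_enum.
  exists (line (p0, 0)); first by apply: map_f; rewrite mem_head.
  exists p0; split; last exact: p0F.
  by have := lineP (p0, 0) 0; rewrite scaler0 addr0.
Qed.
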